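(* In the worst case, $\Omega(\sigma\, z_{no}\log_\sigma n)$ substring queries are necessary to reconstruct a string of length $n$ over an alphabet of size $\sigma$: for any adaptive reconstruction algorithm there are strings $S$ of length $n$ on which it asks $\Omega(\sigma\, z_{no}(S)\log_\sigma n)$ substring queries.
   Context: A substring oracle knows the hidden string $S$ and answers queries of the form ''Is $s$ a substring of $S$?'' with yes/no; an adaptive reconstruction algorithm chooses queries depending on previous answers and must determine $S$ exactly. $z_{no}(S)$ is the number of phrases of the Lempel–Ziv 1977 factorization of $S$ without overlaps: $S$ is parsed left to right into phrases, where each new phrase is either a single character not occurring earlier in $S$, or the longest string starting at the current position that also occurs in $S$ at an earlier starting position with that earlier occurrence not overlapping the phrase itself.
   Formalization: The formal theorem assumes 2 ≤ σ ≤ n and n large: for alphabets much larger than the text (e.g. σ = n³) the bound fails, since σ + O(n²) queries always suffice while z_no is at least log n. *)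

(* Defs.v *)
From mathcomp Require Import all_boot.
From Stdlib Require Import Reals.
Set Implicit Arguments. Unset Strict Implicit. Unset Printing Implicit Defensive.

Section LZ.
Variable A : eqType.

Definition prev_occ (S : seq A) (i l : nat) : bool :=
  has (fun j => (j + l <= i) && (take l (drop j S) == take l (drop i S)))
      (iota 0 i).

(* Length of the phrase starting at position i: the longest l (with
   i + l <= size S) having an earlier non-overlapping occurrence, or 1 if
   there is none (i.e. S[i] does not occur earlier in S). *)
Definition phrase_len (S : seq A) (i : nat) : nat :=
  maxn 1 (\max_(l <- iota 0 (size S - i).+1 | prev_occ S i l) l).

(* number of phrases of the parse of S starting at position i (fuel-bounded;
   fuel = size S suffices since every phrase has length >= 1) *)
Fixpoint lz_count (S : seq A) (fuel i : nat) : nat :=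
  match fuel with
  | 0 => 0
  | k.+1 => if i < size S then (lz_count S k (i + phrase_len S i)).+1 else 0
  end.

Definition z_no (S : seq A) : nat := lz_count S (size S) 0.

(* An adaptive reconstruction algorithm is a decision tree: at an inner node
   it asks "is q a substring of S?" and continues in the yes/no subtree; at a
   leaf it outputs its reconstruction. *)
Inductive qtree : Type :=
| Answer of seq A
| Ask of seq A & qtree & qtree.

Definition is_substring (q S : seq A) : bool := infix q S.

Fixpoint run_output (t : qtree) (S : seq A) : seq A :=
  match t with
  | Answer s => s
  | Ask q ty tn => run_output (if is_substring q S then ty else tn) S
  end.

Fixpoint run_queries (t : qtree) (S : seq A) : nat :=
  match t with
  | Answer _ => 0
  | Ask q ty tn => (run_queries (if is_substring q S then ty else tn) S).+1
  end.

Definition reconstructs (n : nat) (t : qtree) : Prop :=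
  forall S : seq A, size S = n -> run_output t S = S.
End LZ.

Definition logb (b x : R) : R := (ln x / ln b)%R.

(* Main.v *)
Require Import Defs.
From mathcomp Require Import all_boot.
From Stdlib Require Import Reals.
From mathcomp Require Import fingroup perm ssrnat zify.
From Stdlib Require Import Lra.
Set Implicit Arguments. Unset Strict Implicit. Unset Printing Implicit Defensive.

(** Let s be about sigma / 8 and k maximal with 5 k s^k <= n.  For every j < k and
    every context c in [s]^(k-1) choose a permutation of [s].  They act on words
    l in [s]^k (labels): write l and append k more letters, where letter k + j is
    the image of letter j under the permutation attached to j and the k - 1 letters
    in between.  The hidden text concatenates, over all labels l, the resulting
    word of length 2k and its reversal; the two halves of a word use disjoint
    alphabets.  A factor of length at most k reveals nothing, because for every
    split the letters on its two sides take all values as l varies; a longer factor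
    is present iff the permutations have the edges c_i -> y that can be read off it.
    The palindromes keep the order of the labels fixed while the junctions between
    consecutive blocks only expose label letters.

    So a query is a conjunction of edges "this permutation maps x to y".  Answering
    "no" whenever possible costs the adversary one edge, and when a single family
    of permutations is left, each swap of two values must use a removed edge:
    k s^(k-1) s(s-1)/2 queries.  On the other hand a text of length O(k s^k) over
    O(s) letters has O(s^k) phrases, since only O(s^k) positions start a factor of
    length h = k/6 with no earlier disjoint occurrence.  Texts are padded to length
    n by a constant tail, which costs O(log n) phrases.  For sigma < 16 counting the
    2^N binary words of length N = 4 k 2^k replaces the adversary. *)

(** * Query lower bounds: adversary argument and counting *)

Section Queries.
Variable A : eqType.

(* The adversary answers "no" whenever some p consistent with the earlier
   answers allows it, and pays for this by removing a single e. *)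
Lemma adversary (P : finType) (E : eqType) (inc : P -> E -> bool)
    (S : P -> seq A) (K : nat) :
  (forall q p p0, infix q (S p0) -> ~~ infix q (S p) ->
     exists2 e, ~~ inc p e & forall p', infix q (S p') -> inc p' e) ->
  (forall (R : seq E) p, all (fun e => ~~ inc p e) R ->
     (forall p', all (fun e => ~~ inc p' e) R -> S p' = S p) ->
     K <= size R) ->
  P ->
  forall t : qtree A, (forall p, run_output t (S p) = S p) ->
  exists p, K <= run_queries t (S p).
Proof.
move=> sep count p1 t corr.
(* [R] collects the removed elements. It grows by at most one per query, which makes the sum in this
   claim provable by induction on the tree. *)
suff H : forall (R : seq E), (exists p, all (fun e => ~~ inc p e) R) ->
    (forall p, all (fun e => ~~ inc p e) R -> run_output t (S p) = S p) ->
    exists2 p, all (fun e => ~~ inc p e) R & K <= size R + run_queries t (S p).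
  by have [||p _ Kp] := H [::]; [exists p1 | | exists p].
elim: t {corr} => [s | q ty IHy tn IHn] R [p pR] corr /=.
  exists p => //; rewrite addn0; apply: (count R p) => // p' p'R.
  by rewrite -(corr _ p'R) -(corr _ pR).
have [/existsP[p2 /andP[p2R qp2]]|] :=
  boolP [exists p2, all (fun e => ~~ inc p2 e) R && ~~ infix q (S p2)].
  (* [sep] needs some text that contains [q]; without one the answer no is forced and nothing is
     removed. *)
  have [/existsP[p0 qp0]|] := boolP [exists p0, infix q (S p0)].
    have [e ep2 He] := sep _ _ _ qp0 qp2.
    have nq p' : ~~ inc p' e -> infix q (S p') = false.
      by move=> h; apply: contraNF h; apply: He.
    have [||p3 /andP[ep3 p3R] Kp3] := IHn (e :: R).
    - by exists p2; rewrite /= ep2.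
    - move=> p' /andP[ep' p'R]; move: (corr p' p'R) => /=.
      by rewrite /is_substring nq.
    exists p3 => //; move: Kp3; rewrite /is_substring nq //= addnS; lia.
  rewrite negb_exists => /forallP nq.
  have [||p3 p3R Kp3] := IHn R.
  - by exists p.
  - move=> p' p'R; move: (corr p' p'R) => /=.
    by rewrite /is_substring (negbTE (nq p')).
  by exists p3 => //; rewrite /is_substring (negbTE (nq p3)); lia.
rewrite negb_exists => /forallP yq.
have {}yq p' : all (fun e => ~~ inc p' e) R -> infix q (S p').
  by move=> p'R; move: (yq p'); rewrite p'R /= negbK.
have [||p3 p3R Kp3] := IHy R.
- by exists p.
- by move=> p' p'R; move: (corr p' p'R) => /=; rewrite /is_substring yq.
by exists p3 => //; rewrite /is_substring yq //; lia.
Qed.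

(** One of the two answers keeps at least half of the candidates, and a leaf is correct for at most
    one of them. *)
Lemma information_bound (t : qtree A) (L : seq (seq A)) (d : nat) :
  uniq L -> {in L, forall S, run_output t S = S} -> 2 ^ d <= size L ->
  exists2 S, S \in L & d <= run_queries t S.
Proof.
elim: t L d => [s | q ty IHy tn IHn] L d uL corr szL.
  have L1 : size L <= 1.
    apply: (@uniq_leq_size _ L [:: s] uL) => x xL.
    by rewrite inE -(corr x xL) /=.
  have L0 : 0 < size L by apply: leq_trans szL; rewrite expn_gt0.
  exists (nth [::] L 0); first exact: mem_nth.
  by case: d szL => // d; rewrite expnS; have := expn_gt0 2 d; lia.
case: d szL => [|d] szL.
  by exists (nth [::] L 0); first by apply: mem_nth; move: szL; rewrite expn0.
have := count_predC (infix q) L; rewrite -!size_filter => eL.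
move: szL; rewrite expnS => szL.
have [szy|szn] := leqP (2 ^ d) (size (filter (infix q) L)).
  have [|S] := IHy _ d (filter_uniq _ uL) _ szy.
    move=> x; rewrite mem_filter => /andP[qx xL].
    by move: (corr x xL); rewrite /= /is_substring qx.
  by rewrite mem_filter => /andP[qx xL] dS; exists S; rewrite //= /is_substring qx.
have szn' : 2 ^ d <= size (filter (predC (infix q)) L) by lia.
have [|S] := IHn _ d (filter_uniq _ uL) _ szn'.
  move=> x; rewrite mem_filter /= => /andP[qx xL].
  by move: (corr x xL); rewrite /= /is_substring (negbTE qx).
rewrite mem_filter /= => /andP[qx xL] dS.
by exists S; rewrite //= /is_substring (negbTE qx).
Qed.

End Queries.

(** * Upper bounds on the number of phrases *)

Section Parsing.
Variable A : finType.
Implicit Type S : seq A.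

Lemma phrase_len_gt0 S i : 0 < phrase_len S i.
Proof. by rewrite /phrase_len; lia. Qed.

Lemma prev_occ_phrase_len S i l :
  i + l <= size S -> prev_occ S i l -> l <= phrase_len S i.
Proof.
move=> il occ; rewrite /phrase_len leq_max; apply/orP; right.
have lr : l \in iota 0 (size S - i).+1 by rewrite mem_iota; lia.
by rewrite (big_rem l lr) /= occ leq_maxl.
Qed.

Lemma lz_count_leq S f i : lz_count S f i <= size S - i.
Proof.
elim: f i => //= f IH i; case: ltnP => // iS.
by have := IH (i + phrase_len S i); have := phrase_len_gt0 S i; lia.
Qed.

Lemma prev_occ_shift S i d l : 0 < d -> d <= i -> l <= d ->
  take l (drop (i - d) S) = take l (drop i S) -> prev_occ S i l.
Proof.
move=> d0 di ld e; apply/hasP; exists (i - d); first by rewrite mem_iota; lia.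
by rewrite e eqxx andbT; lia.
Qed.

(* A factor of length h that first occurs at i can only reoccur at distance
   less than h without creating a non-overlapping previous occurrence. *)
Lemma card_no_prev_occ S N h : 0 < h -> N + h <= size S ->
  count (fun i => ~~ prev_occ S i h) (iota 0 N) <= h * #|A| ^ h.
Proof.
move=> h0 Nh.
pose B := [set i : 'I_N | ~~ prev_occ S i h].
have -> : count (fun i => ~~ prev_occ S i h) (iota 0 N) = #|B|.
  rewrite -val_enum_ord count_map cardE -size_filter.
  congr size; rewrite enumT /enum_mem; apply: eq_filter => i /=.
  by rewrite inE.
have [->|/set0Pn[i0 _]] := eqVneq B set0; first by rewrite cards0.
have x0 : A.
  by case: (S) Nh => [|x //]; rewrite /=; lia.
pose w (i : 'I_N) : h.-tuple A := [tuple nth x0 S (i + j) | j < h].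
(* Equal windows at distinct positions congruent modulo [h] are at least [h] apart, so the earlier
   one is a non-overlapping occurrence. Hence [g] is injective on [B]. *)
pose g (i : 'I_N) := (w i, Ordinal (ltn_pmod i h0)).
have sz (i : 'I_N) : i + h <= size S by have := ltn_ord i; lia.
have win (i : 'I_N) : take h (drop i S) = w i :> seq A.
  have hw : size (take h (drop i S)) = h.
    by rewrite size_takel // size_drop; have := sz i; lia.
  apply: (@eq_from_nth _ x0); first by rewrite hw size_tuple.
  rewrite hw => j jh.
  rewrite nth_take // nth_drop -[j in RHS]/(nat_of_ord (Ordinal jh)) -tnth_nth.
  by rewrite tnth_mktuple.
have ginj : {in B &, injective g}.
  move=> i j; rewrite !inE => ni nj gE.
  have ew := congr1 fst gE; have /(congr1 val)/= em := congr1 snd gE.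
  rewrite /= in ew.
  have {}ew : take h (drop i S) = take h (drop j S) by rewrite !win [w i]ew.
  apply/val_inj => /=; have [ij|ji|//] := ltngtP i j.
  - case/negP: nj; have e := @subnKC i j (ltnW ij).
    have dv : h %| j - i by rewrite -eqn_mod_dvd ?em // ltnW.
    apply: (@prev_occ_shift S j (j - i)); try lia.
      by apply: dvdn_leq dv; lia.
    by rewrite (_ : j - (j - i) = i) //; lia.
  - case/negP: ni.
    have dv : h %| i - j by rewrite -eqn_mod_dvd ?em // ltnW.
    apply: (@prev_occ_shift S i (i - j)); try lia.
      by apply: dvdn_leq dv; lia.
    by rewrite (_ : i - (i - j) = j) //; lia.
rewrite -(card_in_imset ginj); apply: leq_trans (max_card _) _.
by rewrite card_prod card_tuple card_ord mulnC.
Qed.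

(** A phrase that starts before [N] either starts at a counted position or covers at least [h]
    positions. The extra [h] pays for one phrase running past [N]; [T] bounds what follows. *)
Lemma lz_count_split S N h T : 0 < h -> N + h <= size S ->
  (forall f i, N <= i -> lz_count S f i <= T) ->
  forall f i, h * lz_count S f i <=
    h * count (fun i => ~~ prev_occ S i h) (iota i (N - i)) + (N - i) + h + h * T.
Proof.
move=> h0 Nh HT; elim=> [|f IH] i; first by rewrite /= muln0.
have [Ni|iN] := leqP N i.
  by have := HT f.+1 i Ni; move: (lz_count _ _ _) => c; nia.
have iS : i < size S by lia.
rewrite /= iS.
set i' := i + _; have := IH i'; have i'i : i < i'.
  by have := phrase_len_gt0 S i; rewrite /i'; lia.
set c := count _ (iota i _); set c' := count _ _ => H.
have cc' : ~~ prev_occ S i h + c' <= c.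
  rewrite /c /c' (_ : N - i = (N - i).-1.+1) /=; last lia.
  rewrite leq_add2l; have [Ni'|i'N] := leqP N i'.
    by rewrite (_ : N - i' = 0) //=; lia.
  rewrite (_ : (N - i).-1 = (i' - i.+1) + (N - i')); last lia.
  rewrite iotaD count_cat (_ : i.+1 + (i' - i.+1) = i'); last lia.
  exact: leq_addl.
move: cc'; case occ: (prev_occ S i h) => /= cc'; last first.
  move: H; set z := lz_count _ _ _; clear -i'i cc'.
  move=> H; have : h * (1 + c') <= h * c by rewrite leq_mul2l cc' orbT.
  by rewrite mulnS mulnDr muln1; lia.
have hl := prev_occ_phrase_len (_ : i + h <= size S) occ.
have {}hl : i + h <= i' by rewrite /i' leq_add2l hl //; lia.
have hc : h * c' <= h * c by rewrite leq_mul2l cc' orbT.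
have [Ni'|i'N] := leqP N i'; last by rewrite mulnS; lia.
have := HT f i' Ni'; set z := lz_count _ _ _ => zT.
have : h * z <= h * T by rewrite leq_mul2l zT orbT.
by rewrite mulnS; lia.
Qed.

(** In a constant run a phrase can copy everything between [N] and its own start, so the distance
    from [N] doubles with each phrase until the end is reached. The extra one accounts for a phrase
    starting at [N] itself. *)
Lemma lz_count_constant_tail S N x m :
  (forall i, N <= i < size S -> nth x S i = x) -> size S <= N + 2 ^ m ->
  forall f i, N <= i -> lz_count S f i <= m.+1.
Proof.
move=> Sx Sm.
have H f : forall m' i, N < i -> size S <= N + 2 ^ m' * (i - N) ->
    lz_count S f i <= m'.
  elim: f => //= f IH m' i Ni le; case: ltnP => // iS.
  case: m' le => [|m'] le; first by rewrite expn0 in le; lia.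
  set i' := i + _; rewrite ltnS.
  pose l := minn (i - N) (size S - i).
  have il : i + l <= i'.
    rewrite leq_add2l; apply: prev_occ_phrase_len; first by rewrite /l; lia.
    apply: (@prev_occ_shift S i (i - N)); try (rewrite /l; lia).
    rewrite (_ : i - (i - N) = N); last lia.
    have sz j : j <= i -> size (take l (drop j S)) = l.
      by move=> ji; rewrite size_takel // size_drop /l; lia.
    apply: (@eq_from_nth _ x); first by rewrite !sz ?leqnn //; apply: ltnW.
    rewrite sz; last exact: ltnW.
    move=> j jl.
    rewrite !nth_take // !nth_drop !Sx //; move: jl; rewrite /l; lia.
  have [Si'|i'S] := leqP (size S) i'.
    by apply: leq_trans (lz_count_leq _ _ _) _; lia.
  apply: IH; first by have := phrase_len_gt0 S i; lia.
  have : 2 ^ m' * (2 * (i - N)) <= 2 ^ m' * (i' - N).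
    by rewrite leq_mul2l; apply/orP; right; move: il; rewrite /l; lia.
  by move: le; rewrite expnS mulnCA mulnA; lia.
case=> //= f i Ni; case: ltnP => // iS; rewrite ltnS.
have := phrase_len_gt0 S i; set p := phrase_len _ _ => p0.
apply: H; first lia.
by have := leq_mul (leqnn (2 ^ m)) (_ : 0 < i + p - N); lia.
Qed.

Lemma z_no_leq S N h x m : 0 < h -> N + h <= size S ->
  (forall i, N <= i < size S -> nth x S i = x) -> size S <= 2 ^ m ->
  h * z_no S <= h * (h * #|A| ^ h + m.+2) + N.
Proof.
move=> h0 Nh Sx Sm.
have T := lz_count_constant_tail Sx (leq_trans Sm (leq_addl N _)).
have := lz_count_split h0 Nh T (size S) 0.
have := card_no_prev_occ h0 Nh; rewrite subn0 -/(z_no S).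
set c := count _ _ => cB.
have : h * c <= h * (h * #|A| ^ h) by rewrite leq_mul2l cB orbT.
by rewrite mulnDr [h * m.+2]mulnS; lia.
Qed.

End Parsing.

(** * Factors of concatenations *)

Section Infix.
Variable T : eqType.
Implicit Types q a b u v : seq T.

Lemma infix_cat_split q a b : infix q (a ++ b) ->
  [\/ infix q a, infix q b |
      exists u v, [/\ q = u ++ v, u != [::], v != [::], suffix u a & prefix v b]].
Proof.
case/infixP=> x [y e].
have ea : a = take (size a) (x ++ q ++ y) by rewrite -e take_size_cat.
have eb : b = drop (size a) (x ++ q ++ y) by rewrite -e drop_size_cat.
have [xa|ax] := ltnP (size x) (size a); last first.
  constructor 2; rewrite eb drop_cat; case: ltnP => [|_]; last first.
    by rewrite (_ : size a - size x = 0) ?drop0 ?prefix_infix //; lia.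
  by move=> ?; apply/infixP; exists (drop (size a) x), y.
have [qa|aq] := leqP (size x + size q) (size a).
  constructor 1; rewrite ea take_cat ltnNge ltnW //= take_cat.
  rewrite ltnNge (_ : size q <= _) /=; last lia.
  by apply/infixP; exists x, (take (size a - size x - size q) y).
constructor 3; exists (take (size a - size x) q), (drop (size a - size x) q).
rewrite cat_take_drop -!size_eq0 size_drop size_takel; last lia.
split=> //; try lia.
- apply/suffixP; exists x; rewrite {1}ea take_cat ltnNge ltnW //= take_cat.
  by rewrite (_ : _ - _ < _) //; lia.
- apply/prefixP; exists y; rewrite {1}eb drop_cat ltnNge ltnW //= drop_cat.
  by rewrite (_ : _ - _ < _) //; lia.
Qed.

Variables (I : eqType) (f : I -> seq T).

Lemma prefix_flatten v (ls : seq I) : v != [::] ->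
    prefix v (flatten (map f ls)) ->
  exists mid l ls2 w, [/\ ls = mid ++ l :: ls2, v = flatten (map f mid) ++ w,
                          w != [::] & prefix w (f l)].
Proof.
elim: ls v => [|l ls IH] v v0 /=; first by case: v v0.
case/prefixP=> y e; have [vl|lv] := leqP (size v) (size (f l)).
  exists [::], l, ls, v; split=> //; apply/prefixP.
  exists (take (size (f l) - size v) y).
  have := congr1 (take (size (f l))) e; rewrite take_size_cat // => {1}->.
  by rewrite take_cat ltnNge vl.
have ev : v = f l ++ drop (size (f l)) v.
  have := congr1 (take (size (f l))) e; rewrite take_size_cat // take_cat lv.
  by move=> {1}->; rewrite cat_take_drop.
have [||mid [l2 [ls2 [w [-> ew w0 wl]]]]] := IH (drop (size (f l)) v).
- by rewrite -size_eq0 size_drop; lia.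
- apply/prefixP; exists y.
  by have := congr1 (drop (size (f l))) e; rewrite drop_size_cat // drop_cat lv.
by exists (l :: mid), l2, ls2, w; split=> //=; rewrite -catA -ew.
Qed.

Lemma infix_flatten q (ls : seq I) : q != [::] -> infix q (flatten (map f ls)) ->
  (exists2 l, l \in ls & infix q (f l)) \/
  exists ls1 l1 mid l2 ls2 u v,
    [/\ ls = ls1 ++ l1 :: mid ++ l2 :: ls2, q = u ++ flatten (map f mid) ++ v,
        u != [::] /\ v != [::], suffix u (f l1) & prefix v (f l2)].
Proof.
move=> q0; elim: ls => [|l ls IH] /=; first by case: q q0.
case/infix_cat_split=> [ql | /IH[[l' l's ql']|] | [u [v [-> u0 v0 ul vl]]]].
- by left; exists l; rewrite ?mem_head.
- by left; exists l'; rewrite // inE l's orbT.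
- move=> [ls1 [l1 [mid [l2 [ls2 [u [v [-> eq uv ul vl]]]]]]]].
  by right; exists (l :: ls1), l1, mid, l2, ls2, u, v; split.
have [mid [l2 [ls2 [w [-> -> w0 wl]]]]] := prefix_flatten v0 vl.
by right; exists [::], l, mid, l2, ls2, u, w; split.
Qed.

End Infix.

(** * Words generated by a family of permutations *)

Section Blocks.
Variables (s' m : nat).
Local Notation s := s'.+1.
Local Notation k := m.+1.
Implicit Types (w u : seq 'I_s) (j a : nat).

Definition permFamily := {ffun 'I_k * m.-tuple 'I_s -> {perm 'I_s}}.
Implicit Types p : permFamily.

(* Outside [j < k] and [size w = m] this is a junk value. *)
Definition perm_at p j w : {perm 'I_s} :=
  p (inord j, insubd [tuple of nseq m ord0] w).

(** [a] is the position of [w] in a full word of length [k + k]; the permutation to apply depends on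
    it. *)
Definition valid p a w := forall i, i + k < size w ->
  nth ord0 w (i + k) = perm_at p (a + i) (take m (drop i.+1 w)) (nth ord0 w i).

Definition extend p w := rcons w
  (perm_at p (size w - k) (take m (drop (size w - k).+1 w))
     (nth ord0 w (size w - k))).

Lemma valid_rcons p a w y : valid p a w ->
  (k <= size w -> y = perm_at p (a + (size w - k))
     (take m (drop (size w - k).+1 w)) (nth ord0 w (size w - k))) ->
  valid p a (rcons w y).
Proof.
move=> vw ey i; rewrite size_rcons ltnS => ik.
have iw : i.+1 <= size w by lia.
rewrite !nth_rcons iw drop_rcons // -cats1 takel_cat; last by rewrite size_drop; lia.
move: ik; rewrite leq_eqVlt => /orP[/eqP ik|ik]; last by rewrite ik; apply: vw.
rewrite -ik ltnn eqxx ey; last lia.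
by rewrite (_ : size w - k = i) //; lia.
Qed.

Lemma valid_extend p w : valid p 0 w -> valid p 0 (extend p w).
Proof. by move=> vw; apply: valid_rcons. Qed.

Lemma valid_right p a w n : valid p a w ->
  exists y, size y = n /\ valid p a (w ++ y).
Proof.
elim: n w => [|n IH] w vw; first by exists [::]; rewrite cats0.
have := valid_rcons vw (fun _ => erefl); set z := perm_at _ _ _ _.
by case/IH=> y [sy vy]; exists (z :: y); rewrite /= sy -cat_rcons.
Qed.

(** Extension to the left is possible because permutations are invertible: the inverse yields the
    missing letter. *)
Lemma valid_left p a w : valid p a w ->
  exists x, size x = a /\ valid p 0 (x ++ w).
Proof.
elim: a w => [|a IH] w vw; first by exists [::].
pose z := ((perm_at p a (take m w))^-1)%g (nth ord0 w m).
have [|x [sx vx]] := IH (z :: w).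
  case=> [|i] /= ik; first by rewrite addn0 drop0 permKV.
  by rewrite -[a + i.+1]addSnnS; apply: vw.
by exists (rcons x z); rewrite size_rcons sx cat_rcons.
Qed.

(** This is why short factors carry no information: up to [k] letters validity is vacuous, so such a
    word occurs at any admissible position of some full word, whatever the family. *)
Lemma valid_completion p a w : valid p a w -> a + size w <= k + k ->
  exists W, [/\ valid p 0 W, size W = k + k & take (size w) (drop a W) = w].
Proof.
move=> vw aw; have [x [sx vx]] := valid_left vw.
have [y [sy vy]] := valid_right (k + k - (a + size w)) vx.
exists ((x ++ w) ++ y); split=> //; first by rewrite !size_cat sx sy; lia.
by rewrite -catA drop_size_cat // take_size_cat.
Qed.

Lemma valid_unique p w u : valid p 0 w -> valid p 0 u -> size w = size u ->
  take k w = take k u -> w = u.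
Proof.
move=> vw vu sz tk; apply: (@eq_from_nth _ ord0) => // i.
have [n] := ubnP i; elim: n i => // n IH i; rewrite ltnS => ni iw.
have [ik|ki] := ltnP i k; first by rewrite -(nth_take _ ik) tk nth_take.
rewrite -(subnK ki); rewrite vw ?vu; try lia.
rewrite IH; try lia.
congr (perm_at _ _ _ _); apply: (@eq_from_nth _ ord0).
  by rewrite !size_take !size_drop sz.
move=> j; rewrite size_take size_drop => jl.
have jm : j < m by move: jl; case: ifP; lia.
by rewrite !nth_take // !nth_drop; apply: IH; lia.
Qed.

Definition label := k.-tuple 'I_s.
Implicit Types l : label.

Definition orbit_word p l := iter k (extend p) l.

Lemma orbit_wordP p l :
  [/\ valid p 0 (orbit_word p l), size (orbit_word p l) = k + k
    & take k (orbit_word p l) = l].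
Proof.
suff H n : [/\ valid p 0 (iter n (extend p) l), size (iter n (extend p) l) = k + n
    & take k (iter n (extend p) l) = l] by apply: H.
elim: n => [|n [v sz tk]] /=.
  rewrite addn0 size_tuple take_oversize ?size_tuple //; split=> //.
  by move=> i; rewrite size_tuple; lia.
split; first exact: valid_extend.
  by rewrite /extend size_rcons sz addnS.
by rewrite /extend -cats1 takel_cat ?sz //; lia.
Qed.

Lemma valid_orbit_word p w : valid p 0 w -> size w = k + k ->
  exists2 l : label, w = orbit_word p l & l = take k w :> seq _.
Proof.
move=> vw sw; have sz : size (take k w) == k by rewrite size_takel // sw; lia.
exists (Tuple sz) => //; have [v' sz' tk'] := orbit_wordP p (Tuple sz).
by apply: (valid_unique vw v'); rewrite ?sw ?sz' ?tk'.
Qed.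

(** * Flagged letters and edge words *)

Definition letter : eqType := (bool * 'I_s)%type.

(* The flag of a letter records whether it comes from the label half (positions
   below k) or from the image half of an orbit word. *)
Fixpoint typed a w : seq letter :=
  if w is x :: w' then (a < k, x) :: typed a.+1 w' else [::].

Lemma size_typed a w : size (typed a w) = size w.
Proof. by elim: w a => //= x w IH a; rewrite IH. Qed.

Lemma take_typed n a w : take n (typed a w) = typed a (take n w).
Proof. by elim: w n a => [|x w IH] [|n] a //=; rewrite IH. Qed.

Lemma drop_typed n a w : drop n (typed a w) = typed (a + n) (drop n w).
Proof. by elim: w n a => [|x w IH] [|n] a //=; rewrite ?addn0 // IH addSnnS. Qed.

Lemma typed_drop n w : typed n (drop n w) = drop n (typed 0 w).
Proof. by rewrite drop_typed. Qed.

Lemma typed_values a w : map snd (typed a w) = w.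
Proof. by elim: w a => //= x w IH a; rewrite IH. Qed.

Lemma nth_typed a w i : i < size w ->
  nth (true, ord0) (typed a w) i = (a + i < k, nth ord0 w i).
Proof.
elim: w a i => //= x w IH a [|i] /=; first by rewrite addn0.
by rewrite ltnS addnS -addSn; apply: IH.
Qed.

Definition edge : finType := (('I_k * m.-tuple 'I_s) * ('I_s * 'I_s))%type.
Implicit Types e : edge.

Definition has_edge p e := p e.1 e.2.1 == e.2.2.

(** The window of [k + 1] letters at position [e.1.1] consisting of source, context and target. The
    place where its flags switch reveals the position. *)
Definition edge_word e : seq letter :=
  typed e.1.1 (e.2.1 :: e.1.2 ++ [:: e.2.2]).

Lemma size_edge_word e : size (edge_word e) = k.+1.
Proof. by rewrite size_typed /= size_cat size_tuple addn1. Qed.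

Lemma edge_window w a i : a + i < k -> i + k < size w ->
  exists e, [/\ edge_word e = take k.+1 (drop i (typed a w)),
    forall p, has_edge p e =
      (nth ord0 w (i + k) == perm_at p (a + i) (take m (drop i.+1 w)) (nth ord0 w i))
    & e.1.1 = a + i :> nat].
Proof.
move=> ai iw.
pose c : m.-tuple 'I_s := insubd [tuple of nseq m ord0] (take m (drop i.+1 w)).
have cE : c = take m (drop i.+1 w) :> seq _.
  by rewrite insubdK // unfold_in size_takel // size_drop; lia.
exists ((inord (a + i), c), (nth ord0 w i, nth ord0 w (i + k))).
split; last by rewrite inordK.
  rewrite drop_typed take_typed; congr (typed _ _); first by rewrite /= inordK.
  rewrite [e in _ = e]/= (drop_nth ord0) /=; last lia.
  congr cons; rewrite cE cats1.
  by rewrite addnS -addSn -nth_drop -take_nth // size_drop; lia.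
by move=> p; rewrite /has_edge /= eq_sym.
Qed.

Lemma visible_valid p a w : a + size w <= k + k ->
  (forall e, infix (edge_word e) (typed a w) -> has_edge p e) -> valid p a w.
Proof.
move=> aw H i iw; have ai : a + i < k by lia.
have [e [ew pe _]] := edge_window ai iw.
apply/eqP; rewrite -pe; apply: H; rewrite ew.
apply/infixP; exists (take i (typed a w)), (drop k.+1 (drop i (typed a w))).
by rewrite !cat_take_drop.
Qed.

Lemma edge_word_inj e e' : e.1.1 = e'.1.1 -> edge_word e = edge_word e' -> e = e'.
Proof.
case: e e' => [[j c] [x y]] [[j' c'] [x' y']] /= <- /(congr1 (map snd)).
rewrite !typed_values /= => -[<-] /eqP; rewrite !cats1 eqseq_rcons.
by case/andP=> /eqP/val_inj-> /eqP->.
Qed.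

Lemma nth_edge_word e i : i <= k ->
  (nth (true, ord0) (edge_word e) i).1 = (e.1.1 + i < k).
Proof.
by move=> ik; rewrite nth_typed // /= size_cat size_tuple addn1.
Qed.

Lemma last_edge_word e : (last (true, ord0) (edge_word e)).1 = false.
Proof.
by rewrite -nth_last size_edge_word nth_edge_word // ltnNge leq_addl.
Qed.

Lemma has_edge_window p w e : valid p 0 w -> size w = k + k ->
  edge_word e = take k.+1 (drop e.1.1 (typed 0 w)) -> has_edge p e.
Proof.
move=> vw sw ew; have jk := ltn_ord e.1.1.
have [||e' [ew' pe' je']] := @edge_window w 0 e.1.1; [by [] | by rewrite sw ltn_add2r|].
have <- : e' = e by apply: edge_word_inj; [apply: val_inj | rewrite ew ew'].
by rewrite pe'; apply/eqP/vw; rewrite sw ltn_add2r.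
Qed.

(** * Palindromic blocks and the edges that occur in them *)

Variable pad : nat.

(** The constant tail is treated as one more block: it is a palindrome made of label letters, so its
    junction behaves like the others. *)
Definition block p (o : option label) : seq letter :=
  if o is Some l then typed 0 (orbit_word p l) ++ rev (typed 0 (orbit_word p l))
  else nseq pad (true, ord0).

Lemma size_block p l : size (block p (Some l)) = 4 * k.
Proof.
by rewrite size_cat size_rev size_typed; have [_ -> _] := orbit_wordP p l; lia.
Qed.

Lemma rev_block p o : rev (block p o) = block p o.
Proof.
case: o => [l|] /=; first by rewrite rev_cat revK.
apply: (@eq_from_nth _ (true, ord0)); rewrite size_rev // => i il.
by rewrite nth_rev // !nth_nseq !if_same.
Qed.

Lemma nth_block p l i : i < 4 * k ->
  (nth (true, ord0) (block p (Some l)) i).1 = (i < k) || (3 * k <= i).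
Proof.
move=> ik; have [_ sw _] := orbit_wordP p l; rewrite /= nth_cat size_typed sw.
case: ltnP => ik2; first by rewrite nth_typed ?sw // [3 * k <= i]leqNgt /=; lia.
by rewrite nth_rev size_typed sw ?nth_typed ?sw /=; lia.
Qed.

Lemma last_block_suffix p o (u : seq letter) : u != [::] -> suffix u (block p o) ->
  (last (true, ord0) u).1.
Proof.
case: u => // x u _ /suffixP[y ey].
have -> : last (true, ord0) (x :: u) = last (true, ord0) (block p o).
  by rewrite ey last_cat.
case: o {ey} => [l|]; last by rewrite /=; elim: (pad).
by rewrite -nth_last size_block nth_block; lia.
Qed.

(** A labelled block starts with [k] label letters, so a prefix ending in an image letter contains
    all of them; the tail has no image letters. *)
Lemma block_prefix_count p o v : prefix v (block p o) ->
  (last (true, ord0) v).1 = false -> k <= count fst v.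
Proof.
rewrite prefixE => /eqP ev lv; have v0 : v != [::] by case: (v) lv.
case: o ev => [l|] ev; last first.
  have : all fst v by apply/allP => x; rewrite -ev => /mem_take/nseqP[->].
  by case/lastP: (v) lv => // w x; rewrite last_rcons all_rcons => ->.
have sv : size v <= 4 * k by rewrite -ev size_take size_block; case: ifP; lia.
have v1 : 0 < size v by rewrite lt0n size_eq0.
have kv : k < size v.
  have := nth_block p l (_ : (size v).-1 < 4 * k).
  rewrite -(nth_take (n0 := size v)); last lia.
  by rewrite ev nth_last lv => /(_ _); lia.
have -> : count fst v = count fst (take k v) + count fst (drop k v).
  by rewrite -count_cat cat_take_drop.
suff -> : count fst (take k v) = k by apply: leq_addr.
rewrite -[RHS](@size_takel k _ v); last exact: ltnW.
apply/eqP; rewrite -all_count; apply/(all_nthP (true, ord0)) => i.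
rewrite size_takel; last exact: ltnW.
move=> ik; rewrite nth_take // -ev nth_take; last lia.
by rewrite nth_block ?ik //; lia.
Qed.

Lemma edge_word_count e : count fst (edge_word e) <= k.
Proof.
rewrite -ltnS -(size_edge_word e) ltn_neqAle count_size andbT -all_count.
apply/negP=> /(all_nthP (true, ord0))/(_ k).
by rewrite size_edge_word => /(_ (ltnSn k)); rewrite nth_edge_word // ltnNge leq_addl.
Qed.

Lemma edge_word_in_block p o e : infix (edge_word e) (block p o) -> has_edge p e.
Proof.
case/infixP=> x [y eB].
have nB i : i <= k -> nth (true, ord0) (block p o) (size x + i) =
    nth (true, ord0) (edge_word e) i.
  move=> ik; rewrite eB nth_cat ifF; last by rewrite ltnNge leq_addr.
  by rewrite addKn nth_cat size_edge_word ltnS ik.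
have jk := ltn_ord e.1.1.
case: o eB nB => [l|] eB nB; last first.
  have := congr1 fst (nB k (leqnn _)).
  by rewrite nth_edge_word // nth_nseq if_same ltnNge leq_addl.
have sx : size x + k.+1 <= 4 * k.
  by rewrite -(size_block p l) eB !size_cat size_edge_word; lia.
(* In a block the flags turn from true to false only between positions [k - 1] and [k]. Matching
   this with the switch in the edge word forces the occurrence to start at [e.1.1]. *)
have n1 := congr1 fst (nB (k.-1 - e.1.1) _).
have n2 := congr1 fst (nB (k - e.1.1) _).
rewrite nth_edge_word ?nth_block in n1; [|lia..].
rewrite nth_edge_word ?nth_block in n2; [|lia..].
have {n1} n1 := n1 ltac:(lia); have {n2} n2 := n2 ltac:(lia).
have sxj : size x = e.1.1 by lia.
have [vw sw _] := orbit_wordP p l.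
apply: (has_edge_window vw sw).
have : edge_word e = take k.+1 (drop (size x) (block p (Some l))).
  by rewrite eB drop_size_cat // take_size_cat ?size_edge_word.
rewrite sxj /block drop_cat size_typed sw.
have -> : e.1.1 < k + k by lia.
by rewrite takel_cat // size_drop size_typed sw; lia.
Qed.

Definition blocks p os := flatten (map (block p) os).

Lemma rev_blocks p os : rev (blocks p os) = blocks p (rev os).
Proof.
rewrite /blocks; elim: os => //= o os IH.
by rewrite rev_cat IH rev_block rev_cons map_rcons flatten_rcons.
Qed.

(** An edge word has at most [k] label letters and ends with an image letter. Across a junction it
    would contain the last label letter of one block and [k] more from the block where it ends. *)
Lemma edge_word_in_blocks p os e : infix (edge_word e) (blocks p os) -> has_edge p e.
Proof.
case/infix_flatten; first by rewrite -size_eq0 size_edge_word.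
  by case=> o _; apply: edge_word_in_block.
case=> [os1 [o1 [mid [o2 [os2 [u [v [_ ew [u0 v0] uo vo]]]]]]]].
have lv : (last (true, ord0) v).1 = false.
  by rewrite -(last_edge_word e) ew !last_cat; case: (v) v0.
have := edge_word_count e; rewrite ew !count_cat.
have := block_prefix_count vo lv; have := last_block_suffix u0 uo.
case/lastP: u u0 {ew uo} => // u x _; rewrite last_rcons -cats1 count_cat /= => ->.
lia.
Qed.

Lemma rev_edge_word_in_blocks p os e :
  infix (rev (edge_word e)) (blocks p os) -> has_edge p e.
Proof. by rewrite infix_revLR rev_blocks; apply: edge_word_in_blocks. Qed.

(** * Transfer of factors between families that agree on visible edges *)

Definition visible e q := infix (edge_word e) q || infix (rev (edge_word e)) q.

Definition agrees p q := forall e, visible e q -> has_edge p e.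

Lemma agrees_infix p q q' : infix q' q -> agrees p q -> agrees p q'.
Proof.
move=> qq pq e; rewrite /visible => /orP[] h; apply: pq; rewrite /visible.
  by rewrite (infix_trans h qq).
by rewrite (infix_trans h qq) orbT.
Qed.

(** Since [visible] admits both reading directions, agreement is invariant under reversal, as
    palindromic blocks require. *)
Lemma agrees_rev p q : agrees p (rev q) -> agrees p q.
Proof.
move=> pq e ve; apply: pq; move: ve.
by rewrite /visible infix_rev -infix_revLR orbC.
Qed.

Lemma agrees_completion p a u : a + size u <= k + k -> agrees p (typed a u) ->
  exists l', take (size u) (drop a (orbit_word p l')) = u /\
    (a = 0 -> k <= size u -> l' = take k u :> seq _).
Proof.
move=> au pu.
have vu : valid p a u by apply: visible_valid => // e h; apply: pu; rewrite /visible h.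
have [W [vW sW tW]] := valid_completion vu au.
have [l eW lE] := valid_orbit_word vW sW; exists l; rewrite -eW.
split=> // a0 ku; by rewrite lE -[in RHS]tW a0 drop0 take_takel.
Qed.

Lemma agrees_suffix_orbit p p0 l v : suffix v (typed 0 (orbit_word p0 l)) ->
  agrees p v -> exists l', suffix v (typed 0 (orbit_word p l')).
Proof.
have [_ sw _] := orbit_wordP p0 l; case/suffixP=> y ew pv.
have sy : size y + size v = k + k by rewrite -size_cat -ew size_typed.
have ev : v = typed (size y) (drop (size y) (orbit_word p0 l)).
  by rewrite typed_drop ew drop_size_cat.
have su : size (drop (size y) (orbit_word p0 l)) = size v.
  by rewrite size_drop sw; lia.
have [||l' [el _]] := @agrees_completion p (size y) (drop (size y) (orbit_word p0 l)).
- by rewrite su; lia.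
- by rewrite -ev.
exists l'; apply/suffixP; exists (take (size y) (typed 0 (orbit_word p l'))).
rewrite su in el; rewrite ev -el [take (size v) _]take_oversize; last first.
  by rewrite size_drop; have [_ -> _] := orbit_wordP p l'; lia.
by rewrite typed_drop cat_take_drop.
Qed.

Lemma agrees_infix_orbit p p0 l v : infix v (typed 0 (orbit_word p0 l)) ->
  agrees p v -> exists l', infix v (typed 0 (orbit_word p l')).
Proof.
have [_ sw _] := orbit_wordP p0 l; case/infixP=> x [y ew] pv.
have sy : size x + size v <= k + k.
  by rewrite -sw -(size_typed 0) ew !size_cat; lia.
pose u := take (size v) (drop (size x) (orbit_word p0 l)).
have su : size u = size v by rewrite size_takel // size_drop sw; lia.
have ev : v = typed (size x) u.
  by rewrite -take_typed typed_drop ew drop_size_cat // take_size_cat.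
have [||l' [el _]] := @agrees_completion p (size x) u.
- by rewrite su.
- by rewrite -ev.
exists l'; apply/infixP; exists (take (size x) (typed 0 (orbit_word p l'))).
exists (drop (size v) (drop (size x) (typed 0 (orbit_word p l')))).
by rewrite {1}ev -el -take_typed typed_drop su !cat_take_drop.
Qed.

(** Here the label itself is preserved, as the fixed order of the labels demands: a short prefix
    lies inside the label, and one of at least [k] letters determines it. *)
Lemma agrees_prefix_orbit p p0 l v : prefix v (typed 0 (orbit_word p0 l)) ->
  agrees p v -> prefix v (typed 0 (orbit_word p l)).
Proof.
have [_ sw tl] := orbit_wordP p0 l; have [_ sw' tl'] := orbit_wordP p l.
case/prefixP=> y ew pv.
have sy : size v <= k + k by rewrite -sw -(size_typed 0) ew size_cat leq_addr.
pose u := take (size v) (orbit_word p0 l).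
have su : size u = size v by rewrite size_takel // sw.
have ev : v = typed 0 u by rewrite -take_typed ew take_size_cat.
have [kv|vk] := leqP k (size v); last first.
  rewrite prefixE take_typed {2}ev; apply/eqP; congr typed.
  by rewrite -(take_takel _ (ltnW vk)) tl' -tl take_takel // ltnW.
have [||l' [el ll]] := @agrees_completion p 0 u.
- by rewrite su.
- by rewrite -ev.
have e : l' = l.
  apply: val_inj => /=; rewrite ll // ?su // -tl /u take_takel //.
by rewrite prefixE take_typed -e {2}ev -el drop0 su.
Qed.

Lemma agrees_prefix_block p p0 o v : prefix v (block p0 o) -> agrees p v ->
  prefix v (block p o).
Proof.
case: o => [l|] //= vb pv; set b := typed 0 _ in vb; set b' := typed 0 _.
have sb : size b' = size b.
  rewrite !size_typed; have [_ -> _] := orbit_wordP p l.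
  by have [_ -> _] := orbit_wordP p0 l.
have [vs|sv] := leqP (size v) (size b).
  apply/prefix_catl/(agrees_prefix_orbit (p0 := p0)) => //.
  by move: vb; rewrite !prefixE takel_cat.
(* A prefix longer than half the block contains the whole orbit word, so both families give the same
   block. *)
have bv : prefix b v.
  rewrite prefixE; move: vb; rewrite prefixE => /eqP <-.
  by rewrite take_takel ?take_size_cat // ltnW.
suff -> : b' = b by [].
have : prefix b b'.
  apply: (agrees_prefix_orbit (p0 := p0)); first exact: prefix_refl.
  by apply: agrees_infix pv; apply: prefixW.
by rewrite prefixE -sb take_size => /eqP.
Qed.

Lemma agrees_block p p0 o : agrees p (block p0 o) -> block p o = block p0 o.
Proof.
move=> pb; have := agrees_prefix_block (prefix_refl _) pb.
rewrite prefixE => /eqP <-; rewrite take_oversize //.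
by case: o {pb} => [l|] //=; rewrite !size_block.
Qed.

Lemma agrees_suffix_block p p0 o v : suffix v (block p0 o) -> agrees p v ->
  suffix v (block p o).
Proof.
rewrite -(rev_block p0) -(rev_block p) -!prefix_revLR => vb pv.
by apply: agrees_prefix_block vb _; apply: agrees_rev; rewrite revK.
Qed.

(* By the palindromic shape of a block, the longer of the two arms of a factor
   that straddles its middle determines the shorter one. *)
Lemma agrees_infix_block p p0 o v : infix v (block p0 o) -> agrees p v ->
  exists o', infix v (block p o').
Proof.
case: o => [l|]; last by exists None.
case/infix_cat_split=> [vb | vb | [x [y [-> _ _ xb yb]]]] pv.
- have [l' h] := agrees_infix_orbit vb pv; exists (Some l').
  exact: infix_catr.
- move: vb; rewrite -infix_revLR => vb.
  have pv' : agrees p (rev v) by apply: agrees_rev; rewrite revK.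
  have [l' h] := agrees_infix_orbit vb pv'; exists (Some l').
  by apply: infix_catl; rewrite -infix_revLR.
move: yb; rewrite -suffix_revLR => yb.
suff [l' [xl yl]] : exists l', suffix x (typed 0 (orbit_word p l')) /\
    suffix (rev y) (typed 0 (orbit_word p l')).
  exists (Some l') => /=; move: yl; rewrite suffix_revLR.
  case/suffixP: xl => [x' ->] /prefixP[y' ->].
  by apply/infixP; exists x', y'; rewrite !catA.
have px : agrees p x by apply: agrees_infix pv; apply: prefix_infix.
have py : agrees p (rev y).
  by apply: agrees_rev; rewrite revK; apply: agrees_infix pv; apply: suffix_infix.
have suf2 (b u w : seq letter) : suffix u b -> suffix w b -> size u <= size w ->
    suffix u w.
  case/suffixP=> b1 -> /suffixP[b2 e] uw; apply/suffixP.
  exists (take (size w - size u) w); have := congr1 size e; rewrite !size_cat => se.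
  have := congr1 (drop (size b1)) e; rewrite drop_size_cat // drop_cat.
  have b21 : size b2 <= size b1 by lia.
  rewrite ltnNge b21 /=.
  by rewrite (_ : size b1 - size b2 = size w - size u); [move=> {2}-> | lia];
     rewrite cat_take_drop.
have [xy|yx] := leqP (size x) (size (rev y)).
  have [l' h] := agrees_suffix_orbit yb py; exists l'; split=> //.
  exact: suffix_trans (suf2 _ _ _ xb yb xy) h.
have [l' h] := agrees_suffix_orbit xb px; exists l'; split=> //.
exact: suffix_trans (suf2 _ _ _ yb xb (ltnW yx)) h.
Qed.

Definition text p := blocks p (rcons (map Some (enum {: label})) None).

Lemma mem_text_blocks o : o \in rcons (map Some (enum {: label})) None.
Proof.
rewrite mem_rcons inE; case: o => //= l.
by apply: map_f; rewrite mem_enum.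
Qed.

Lemma infix_block_blocks p o os : o \in os -> infix (block p o) (blocks p os).
Proof.
case/splitPr=> os1 os2; rewrite /blocks map_cat flatten_cat [flatten (map _ (o :: _))]/=.
exact: infix_infix.
Qed.

(** A factor inside one block may move to a block with another label. A factor crossing junctions
    stays in place: the blocks it contains coincide for [p] and [p0], and its ends survive as a
    suffix and a prefix. *)
Lemma agrees_infix_text p p0 q : infix q (text p0) -> agrees p q ->
  infix q (text p).
Proof.
have [->|q0] := eqVneq q [::]; first by rewrite !infix0s.
move=> qt pq; case: (infix_flatten q0 qt) => [[o _ qo]|].
  have [o' qo'] := agrees_infix_block qo pq.
  by apply: infix_trans qo' _; apply/infix_block_blocks/mem_text_blocks.
case=> [os1 [o1 [mid [o2 [os2 [u [v [os eq _ uo vo]]]]]]]].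
have pu : agrees p u by apply: agrees_infix pq; rewrite eq prefix_infix.
have pv : agrees p v by apply: agrees_infix pq; rewrite eq catA suffix_infix.
have em : map (block p0) mid = map (block p) mid.
  apply/eq_in_map => o om; apply/esym/agrees_block; apply: agrees_infix pq.
  apply: infix_trans (infix_block_blocks p0 om) _.
  by rewrite eq /blocks infix_infix.
case/suffixP: (agrees_suffix_block uo pu) => x ex.
case/prefixP: (agrees_prefix_block vo pv) => y ey.
rewrite eq em /text os /blocks map_cat flatten_cat /= map_cat flatten_cat /= ex ey.
apply/infixP; exists (flatten (map (block p) os1) ++ x).
by exists (y ++ flatten (map (block p) os2)); rewrite !catA.
Qed.

(** This is the separation that the adversary requires: if [p] had all edges visible in [q], then
    [q] would occur in its text. *)
Lemma edge_separation q p p0 : infix q (text p0) -> ~~ infix q (text p) ->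
  exists2 e, ~~ has_edge p e & forall p', infix q (text p') -> has_edge p' e.
Proof.
move=> q0 nq.
have [/existsP[e /andP[ve ne]]|] := boolP [exists e, visible e q && ~~ has_edge p e].
  exists e => // p' qp'; case/orP: ve => ve.
    by apply: edge_word_in_blocks (infix_trans ve qp').
  by apply: rev_edge_word_in_blocks (infix_trans ve qp').
rewrite negb_exists => /forallP ap; case/negP: nq; apply: agrees_infix_text q0 _.
by move=> e ve; move: (ap e); rewrite ve negbK.
Qed.

(** * Counting the removed edges *)

Lemma edge_word_in_text p e : has_edge p e -> infix (edge_word e) (text p).
Proof.
move=> /eqP pe; set w := e.2.1 :: e.1.2 ++ [:: e.2.2].
have sw : size w = k.+1 by rewrite /= size_cat size_tuple addn1.
have vw : valid p e.1.1 w.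
  move=> i; rewrite sw ltnS -[X in _ <= X]add0n leq_add2r leqn0 => /eqP-> /=.
  rewrite nth_cat size_tuple ltnn subnn /= drop0 take_size_cat ?size_tuple //.
  have ec : e.1 = (inord (e.1.1 + 0), insubd [tuple of nseq m ord0] (e.1.2 : seq _)).
    rewrite addn0 [LHS]surjective_pairing inord_val; congr pair.
    by apply: val_inj; rewrite insubdK // unfold_in size_tuple.
  by rewrite -pe /perm_at -ec.
have jk := ltn_ord e.1.1.
have jw : e.1.1 + size w <= k + k by rewrite sw; lia.
have [W [vW sW tW]] := valid_completion vw jw.
have [l eW _] := valid_orbit_word vW sW.
apply: infix_trans (infix_block_blocks p (mem_text_blocks (Some l))).
apply: infix_catr; apply/infixP; rewrite -eW.
exists (take e.1.1 (typed 0 W)), (drop (size w) (drop e.1.1 (typed 0 W))).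
by rewrite /edge_word -/w -[in typed _ w]tW -take_typed typed_drop !cat_take_drop.
Qed.

(** Exchanging the values of [p c] at [i] and [j] changes the text, so some removed edge belongs to
    the new family but not to [p]; only the two new edges qualify. *)
Lemma swap_hits (R : seq edge) p :
  all (fun e => ~~ has_edge p e) R ->
  (forall p', all (fun e => ~~ has_edge p' e) R -> text p' = text p) ->
  forall c (i j : 'I_s), i != j ->
    ((c, (i, p c j)) \in R) || ((c, (j, p c i)) \in R).
Proof.
move=> pR puniq c i j ij.
pose p' : permFamily := [ffun d => if d == c then (tperm i j * p c)%g else p d].
have : ~~ all (fun e => ~~ has_edge p' e) R.
  apply/negP => p'R; have pe : has_edge p (c, (i, p c i)) by rewrite /has_edge.
  have := edge_word_in_text pe; rewrite -(puniq _ p'R) => /edge_word_in_blocks.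
  rewrite /has_edge /= ffunE eqxx permM tpermL => /eqP/perm_inj ji.
  by rewrite ji eqxx in ij.
case/allPn=> -[d [x y]] eR; rewrite negbK /has_edge /= ffunE => pe.
have := allP pR _ eR; rewrite /has_edge /=; move: pe.
have [dc|_ -> //] := eqVneq d c; subst d; rewrite permM => /eqP.
case: tpermP => [xi|xj|_ _ -> /eqP //] ey _.
  by rewrite -xi ey eR.
by rewrite -xj ey eR orbT.
Qed.

(** The injection [f] turns pairs of distinct letters, taken for every permutation of the family,
    into edges. For each pair, it or its mirror image lands in [R], whence the factor 2. *)
Lemma card_swaps_leq (R : seq edge) p :
  all (fun e => ~~ has_edge p e) R ->
  (forall p', all (fun e => ~~ has_edge p' e) R -> text p' = text p) ->
  k * s ^ m * (s * s.-1) <= 2 * size R.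
Proof.
move=> pR puniq; have hit := swap_hits pR puniq.
pose D := [set z : edge | z.2.1 != z.2.2].
pose f (z : edge) : edge := (z.1, (z.2.1, p z.1 z.2.2)).
pose sw (z : edge) : edge := (z.1, (z.2.2, z.2.1)).
pose Q := [set z in D | f z \in R].
have swK : involutive sw by case=> c [x y].
have finj : injective f.
  by case=> c [x y] [c' [x' y']] [<- <- /perm_inj <-].
have -> : k * s ^ m * (s * s.-1) = #|D|.
  have := cardsC D; rewrite card_prod card_prod card_tuple !card_ord => e1.
  have : #|~: D| = k * s ^ m * s.
    pose g (z : 'I_k * m.-tuple 'I_s * 'I_s) : edge := (z.1, (z.2, z.2)).
    have -> : ~: D = [set g z | z in [set: 'I_k * m.-tuple 'I_s * 'I_s]].
      apply/setP=> -[c [x y]]; rewrite !inE /= negbK; apply/eqP/imsetP.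
        by move=> /= ->; exists (c, y); rewrite ?inE.
      by case=> -[c' z] _ [_ -> ->].
    rewrite card_imset ?cardsT; last by case=> c x [c' x'] [<- <-].
    by rewrite !card_prod card_tuple !card_ord.
  move=> e2; move: e1; rewrite e2 card_prod !card_ord; move: #|D| (k * _) => a b.
  nia.
have QR : #|Q| <= size R.
  rewrite -(card_imset _ finj); apply: leq_trans (card_size R).
  apply/subset_leq_card/subsetP => e /imsetP[z]; rewrite inE => /andP[_ zR] ->.
  exact: zR.
have DQ : D \subset Q :|: (sw @: Q).
  apply/subsetP=> -[c [x y]]; rewrite [_ \in D]inE /= => xy; apply/setUP.
  have [h|h] := orP (hit c x y xy).
    by left; rewrite !inE /= xy.
  right; rewrite -[(c, (x, y))]swK; apply: imset_f.
  by rewrite !inE /= eq_sym xy.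
apply: leq_trans (subset_leq_card DQ) _; apply: leq_trans (leq_card_setU _ _) _.
by rewrite card_imset ?addnn -?mul2n ?leq_mul2l //; apply: can_inj swK.
Qed.

Lemma size_text p : size (text p) = s ^ k * (4 * k) + pad.
Proof.
rewrite /text /blocks map_rcons flatten_rcons size_cat /= size_nseq; congr addn.
rewrite size_flatten /shape -!map_comp.
rewrite (eq_map (g := fun=> 4 * k)); last by move=> l; apply: size_block.
rewrite sumnE big_map big_const_seq count_predT iter_addn_0 -enumT -cardE.
by rewrite card_tuple card_ord mulnC.
Qed.

Lemma nth_text_pad p i : s ^ k * (4 * k) <= i ->
  nth (true, ord0) (text p) i = (true, ord0).
Proof.
move=> Ni; have := size_text p.
rewrite /text /blocks map_rcons flatten_rcons size_cat /= size_nseq => /eqP.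
rewrite eqn_add2r => /eqP sz.
by rewrite nth_cat sz ltnNge Ni /= nth_nseq if_same.
Qed.

End Blocks.

(** * Hard instances over a given alphabet *)

Lemma infix_map_inj (T U : eqType) (f : T -> U) q r : injective f ->
  infix q (map f r) -> exists2 q', q = map f q' & infix q' r.
Proof.
move=> finj /infixP[x [y e]].
have := congr1 (take (size q) \o drop (size x)) e.
rewrite /= drop_size_cat // take_size_cat // -map_drop -map_take => <-.
exists (take (size q) (drop (size x) r)) => //; apply/infixP.
exists (take (size x) r), (drop (size q) (drop (size x) r)).
by rewrite !cat_take_drop.
Qed.

Lemma infix_map (T U : eqType) (f : T -> U) q r :
  infix q r -> infix (map f q) (map f r).
Proof.
case/infixP=> x [y ->]; apply/infixP; exists (map f x), (map f y).
by rewrite !map_cat.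
Qed.

Lemma permutation_family_instance (sg s' m n : nat) (t : qtree 'I_sg.+1) :
  2 * s'.+1 <= sg.+1 -> s'.+1 ^ m.+1 * (4 * m.+1) <= n -> reconstructs n t ->
  exists S : seq 'I_sg.+1, [/\ size S = n,
    forall i, s'.+1 ^ m.+1 * (4 * m.+1) <= i < size S -> nth ord0 S i = ord0
    & m.+1 * s'.+1 ^ m * (s'.+1 * s') <= 2 * run_queries t S].
Proof.
set N := _ * (4 * _) => ssg Nn rec.
(* The flags select disjoint ranges of the alphabet, hence the [2 * s'.+1] letters; the padding
   letter becomes [ord0]. *)
pose enc (z : letter s') : 'I_sg.+1 := inord (z.2 + (if z.1 then 0 else s'.+1)).
have encK (z : letter s') : enc z = z.2 + (if z.1 then 0 else s'.+1) :> nat.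
  by rewrite inordK //; case: z => [[] c] /=; have := ltn_ord c; lia.
have encI : injective enc.
  move=> [b c] [b' c'] /(congr1 val) /=; rewrite !encK /=.
  have := ltn_ord c; have := ltn_ord c'.
  by case: b b' => [] [] cs c's e; try lia; congr pair; apply: val_inj => /=; lia.
pose T := @text s' m (n - N).
pose S (p : permFamily s' m) := map enc (T p).
have sz p : size (S p) = n by rewrite size_map size_text -/N; lia.
set X := _ * (_ * s').
have [||||p Xp] :=
    @adversary _ (permFamily s' m) (edge s' m) (@has_edge s' m) S (uphalf X) _ _ _ t.
(* A query that occurs in some encoded text uses only encoded letters and can be decoded. *)
- move=> q p p0 qp0; have [q' qE qT] := infix_map_inj encI qp0; subst q => nq.
  have nq' : ~~ infix q' (T p) by apply: contra nq; apply: infix_map.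
  have [e ne He] := edge_separation qT nq'; exists e => // p' qp'.
  have [q2 /(inj_map encI) <- qT'] := infix_map_inj encI qp'.
  exact: He qT'.
- move=> R p pR puniq; have := @card_swaps_leq s' m (n - N) R p pR; rewrite -/X => H.
  have {}H : X <= 2 * size R by apply: H => p' p'R; apply: (inj_map encI); apply: puniq.
  by rewrite leq_uphalf_double -mul2n.
- exact: [ffun=> 1%g].
- by move=> p; apply: rec; rewrite sz.
exists (S p); split=> //; last by rewrite mul2n -leq_uphalf_double.
move=> i; rewrite sz => /andP[Ni iN].
rewrite (nth_map (true, ord0)); last by rewrite -(size_map enc) -/(S p) sz.
by rewrite nth_text_pad //; apply: val_inj; rewrite /= encK.
Qed.

(** All binary words of length [N] are candidates, which forces [N] queries. The weaker bound stated
    has the form of the permutation case with [s = 2], so that one estimate serves both. *)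
Lemma binary_instance (sg m n : nat) (t : qtree 'I_sg.+2) :
  2 ^ m.+1 * (4 * m.+1) <= n -> reconstructs n t ->
  exists S : seq 'I_sg.+2, [/\ size S = n,
    forall i, 2 ^ m.+1 * (4 * m.+1) <= i < size S -> nth ord0 S i = ord0
    & m.+1 * 2 ^ m * (2 * 1) <= 2 * run_queries t S].
Proof.
set N := _ * (4 * _) => Nn rec.
pose enc (b : bool) : 'I_sg.+2 := inord b.
have encI : injective enc.
  by move=> b b' /(congr1 val); rewrite /= !inordK; case: b b' => [] [].
pose S (w : N.-tuple bool) := map enc w ++ nseq (n - N) ord0.
have sz w : size (S w) = n by rewrite size_cat size_map size_tuple size_nseq; lia.
have SI : injective S.
  move=> w w' /eqP; rewrite eqseq_cat ?size_map ?size_tuple // => /andP[/eqP e _].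
  by apply: val_inj; apply: inj_map encI _ _ e.
have [|||_ /mapP[w _ ->] dw] := @information_bound _ t (map S (enum {: N.-tuple bool})) N.
- by rewrite map_inj_uniq ?enum_uniq.
- by move=> _ /mapP[w _ ->]; apply: rec.
- by rewrite size_map -cardE card_tuple card_bool.
exists (S w); split=> //.
  move=> i /andP[Ni _]; rewrite nth_cat size_map size_tuple ltnNge Ni /=.
  by rewrite nth_nseq if_same.
have : m.+1 * 2 ^ m <= N by rewrite /N expnS; nia.
by lia.
Qed.

(** * Choice of parameters and final estimates *)

Lemma z_no_padded_leq (sg s m n : nat) (x : 'I_sg) (S : seq 'I_sg) :
  2 <= s -> sg <= 12 * s -> 5 * (m.+1 * s ^ m.+1) <= n -> n <= s ^ (6 * m.+1) ->
  size S = n ->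
  (forall i, s ^ m.+1 * (4 * m.+1) <= i < size S -> nth x S i = x) ->
  z_no S <= 44 * s ^ m.+1.
Proof.
move=> s2 sgs mn nm sz Sx; set K := s ^ m.+1 in mn nm Sx *.
have K2 : 2 <= K by rewrite /K expnS (leq_trans s2) // leq_pmulr // expn_gt0; lia.
(* The window length [q.+1] is about a sixth of [m.+1]: short enough for few distinct windows, long
   enough for few phrases of at least that length. *)
pose q := m %/ 6; have qm : m < 6 * q.+1 by rewrite /q; lia.
have n2 : size S <= 2 ^ (6 * K).
  rewrite sz; apply: leq_trans nm _; rewrite mulnC expnM -/K mulnC expnM leq_exp2r //.
  by apply: ltnW; apply: ltn_expl.
have NS : K * (4 * m.+1) + q.+1 <= size S.
  have : q.+1 <= m.+1 by rewrite /q; lia.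
  by rewrite sz; nia.
have := z_no_leq (ltn0Sn q) NS Sx n2; rewrite card_ord.
have short : q.+1 * sg ^ q.+1 <= 12 * K.
  have e1 : sg ^ q.+1 <= (12 * s) ^ q.+1 by rewrite leq_exp2r.
  (* As [12 <= 2 ^ 4 <= s ^ 4], the constant in [sg <= 12 * s] costs only a power of [s]. The
     exponents in [e4] add up to [6 * q + 1], at most [m.+1]. *)
  have e2 : 12 ^ q <= s ^ (4 * q).
    rewrite expnM; have s16 : 2 ^ 4 <= s ^ 4 by rewrite leq_exp2r.
    by case: (q) => // q'; rewrite leq_exp2r //; apply: leq_trans s16.
  have e3 : q.+1 <= s ^ q.
    apply: leq_trans (ltn_expl q (ltnSn 1)) _.
    by case: (q) => // q'; rewrite leq_exp2r.
  have e4 : s * (s ^ q * (s ^ (4 * q) * s ^ q)) <= K.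
    by rewrite -!expnD -expnS leq_pexp2l /q; lia.
  apply: leq_trans (leq_mul e3 e1) _; rewrite expnMn.
  apply: leq_trans (_ : s ^ q * (12 * s ^ (4 * q) * s ^ q.+1) <= _).
    by rewrite leq_mul2l leq_mul2r [12 ^ _]expnS leq_mul2l e2 !orbT.
  rewrite [s ^ q.+1]expnS.
  apply: leq_trans (_ : 12 * (s * (s ^ q * (s ^ (4 * q) * s ^ q))) <= _).
    by apply/eq_leq; nia.
  by rewrite leq_mul2l e4.
set z := z_no S => H.
have H1 : q.+1 * (q.+1 * sg ^ q.+1 + (6 * K).+2) <= q.+1 * (12 * K + (6 * K).+2).
  by rewrite leq_mul2l leq_add2r short.
have H2 : K * (4 * m.+1) <= q.+1 * (24 * K) by nia.
(* The sum is [12 * K] for windows, [6 * K + 2] for the tail and the phrase entering it, and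
   [24 * K] for long phrases. *)
have : q.+1 * z <= q.+1 * (44 * K).
  apply: leq_trans H _; apply: leq_trans (leq_add H1 H2) _.
  by rewrite -mulnDr leq_mul2l; lia.
by rewrite leq_mul2l.
Qed.

Lemma exists_scale (s n : nat) : 2 <= s -> 5 * s <= n ->
  exists2 m, 5 * (m.+1 * s ^ m.+1) <= n & n <= s ^ (6 * m.+1).
Proof.
move=> s2 sn.
pose P m := 5 * (m.+1 * s ^ m.+1) <= n.
have P0 : exists m, P m by exists 0; rewrite /P expn1 mul1n.
have Pn m : P m -> m <= n by rewrite /P; have := expn_gt0 s m.+1; nia.
case: (ex_maxnP P0 Pn) => m Pm maxm; exists m => //.
(* Maximality bounds [n] by [5 * (m.+2 * s ^ m.+2)], whose factors are at most [s ^ 3], [s ^ m.+1]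
   and [s ^ m.+2]; the exponents total [2 * m + 6]. *)
have : ~~ P m.+1 by apply/negP => /maxm; rewrite ltnn.
rewrite /P -ltnNge => /ltnW nm; apply: leq_trans nm _.
have e1 : 5 <= s ^ 3 by apply: leq_trans (_ : 2 ^ 3 <= _) => //; rewrite leq_exp2r.
have e2 : m.+2 <= s ^ m.+1.
  by apply: leq_trans (ltn_expl m.+1 (ltnSn 1)) _; rewrite leq_exp2r.
apply: leq_trans (leq_mul e1 (leq_mul e2 (leqnn _))) _.
by rewrite -!expnD leq_pexp2l //; lia.
Qed.

Lemma logb_leq (sg n e : nat) : 2 <= sg -> 0 < n -> n <= sg ^ e ->
  (logb (INR sg) (INR n) <= INR e)%R.
Proof.
move=> sg2 n0 ne.
have sgR : (1 < INR sg)%R by apply: (lt_INR 1); apply/ltP.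
have lsg : (0 < ln (INR sg))%R by rewrite -ln_1; apply: ln_increasing => //; lra.
have powE : INR (sg ^ e) = (INR sg ^ e)%R.
  by elim: (e) => //= e' <-; rewrite expnS mult_INR.
have n0R : (0 < INR n)%R by apply: lt_0_INR; apply/ltP.
have : (ln (INR n) <= INR e * ln (INR sg))%R.
  rewrite -ln_pow; last lra.
  have := le_INR _ _ (elimT leP ne); rewrite powE => -[h|->]; last exact: Rle_refl.
  exact/Rlt_le/ln_increasing.
move=> h; rewrite /logb /Rdiv.
apply: (Rmult_le_reg_r (ln (INR sg))) => //.
by rewrite Rmult_assoc Rinv_l ?Rmult_1_r //; lra.
Qed.

(** The constant is [12672 = 12 * 44 * 6 * 4]: 12 compares [sg] with [s], 44 the phrases with
    [s ^ m.+1], 6 the logarithm with [m.+1], and 4 comes from the query count. *)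
Lemma query_bound (sg s m n Q : nat) (S : seq 'I_sg) (x : 'I_sg) :
  2 <= s -> s <= sg -> sg <= 12 * s -> 5 * (m.+1 * s ^ m.+1) <= n ->
  n <= s ^ (6 * m.+1) -> size S = n ->
  (forall i, s ^ m.+1 * (4 * m.+1) <= i < size S -> nth x S i = x) ->
  m.+1 * s ^ m * (s * s.-1) <= 2 * Q ->
  (/ 12672 * INR sg * INR (z_no S) * logb (INR sg) (INR n) <= INR Q)%R.
Proof.
move=> s2 ssg sgs mn nm sz Sx XQ.
have zK := z_no_padded_leq s2 sgs mn nm sz Sx.
have n0 : 0 < n by have := expn_gt0 s m.+1; nia.
have lg : (logb (INR sg) (INR n) <= INR (6 * m.+1))%R.
  apply: logb_leq => //; first lia.
  by apply: leq_trans nm _; rewrite leq_exp2r.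
have Qlow : m.+1 * (s * s ^ m.+1) <= 4 * Q.
  have : m.+1 * s ^ m * (s * s) <= 2 * (m.+1 * s ^ m * (s * s.-1)).
    by rewrite [2 * _]mulnCA leq_mul2l [2 * _]mulnCA leq_mul2l; lia.
  have -> : m.+1 * (s * s ^ m.+1) = m.+1 * s ^ m * (s * s).
    by rewrite expnS; move: (s ^ m) => y; nia.
  by lia.
have : sg * z_no S * (6 * m.+1) <= 12 * 44 * 6 * (4 * Q).
  apply: leq_trans (_ : (12 * s) * (44 * s ^ m.+1) * (6 * m.+1) <= _).
    by rewrite leq_mul2r leq_mul ?orbT.
  apply: leq_trans (leq_mul (leqnn _) Qlow); apply/eq_leq.
  by move: (s ^ m.+1) => y; nia.
move/leP/le_INR; rewrite !mult_INR => H.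
have zs : (0 <= INR sg * INR (z_no S))%R by apply: Rmult_le_pos; apply: pos_INR.
have := Rmult_le_compat_l _ _ _ zs lg; rewrite mult_INR => H2.
have := Rle_trans _ _ _ H2 H.
have [-> -> -> ->] : [/\ INR 12 = 12, INR 44 = 44, INR 6 = 6 & INR 4 = 4]%R.
  by rewrite !INR_IZR_INZ.
by lra.
Qed.

Theorem theorem3 :
  exists c : R, (0 < c)%R /\
  exists n0 : nat,
  forall (sigma n : nat), 2 <= sigma -> sigma <= n -> n0 <= n ->
  forall t : qtree 'I_sigma, reconstructs n t ->
  exists S : seq 'I_sigma, size S = n /\
    (c * INR sigma * INR (z_no S) * logb (INR sigma) (INR n)
       <= INR (run_queries t S))%R.
Proof.
exists (/ 12672)%R; split; first lra.
(* [n >= 10] is what the smallest scale with [s = 2] requires. *)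
exists 10 => -[|[|sg]] // n _ sgn n10 t rec.
have [small|large] := ltnP sg.+2 16.
  have [m mn nm] := exists_scale (leqnn 2) n10.
  have [|S [sz Sx XQ]] := binary_instance (m := m) _ rec; first lia.
  by exists S; split=> //; apply: (query_bound _ _ _ mn nm sz Sx XQ); lia.
(* From 16 letters on, [s = sigma %/ 8] is at least 2, and then [sigma < 8 * s + 8 <= 12 * s]. *)
have [s' es] : exists s', sg.+2 %/ 8 = s'.+2 by exists (sg.+2 %/ 8 - 2); lia.
have [||m mn nm] := @exists_scale s'.+2 n; [lia..|].
have [||S [sz Sx XQ]] := @permutation_family_instance sg.+1 s'.+1 m n t _ _ rec; [lia..|].
by exists S; split=> //; apply: (query_bound _ _ _ mn nm sz Sx XQ); lia.
Qed.
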